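(* Let $P \subset \mathbb{R}^d$ be a polytope with non-empty interior. Then there is a point $c$ in the interior of $P$ such that the sum of the vertices of the polar polytope $(P-c)^\circ$ is equal to zero.
   Context: A polytope is the convex hull of finitely many points in $\mathbb{R}^d$, with $d$ a positive integer. The polar of a set $S \subset \mathbb{R}^d$ is $S^\circ = \{x \in \mathbb{R}^d : \langle x, s\rangle \le 1 \text{ for all } s \in S\}$, where $\langle\cdot,\cdot\rangle$ is the standard inner product. $P - c = \{x - c : x \in P\}$. For $c$ in the interior of $P$, the set $(P-c)^\circ$ is again a polytope; each of its vertices is counted once in the sum. *)

(* Defs.v *)
From HB Require Import structures.
From mathcomp Require Import all_boot all_order all_algebra.
From mathcomp Require Import all_classical all_reals all_analysis.

Set Implicit Arguments.
Unset Strict Implicit.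
Unset Printing Implicit Defensive.

Import Order.TTheory GRing.Theory Num.Theory.
Import numFieldNormedType.Exports.

Local Open Scope classical_set_scope.
Local Open Scope ring_scope.

Definition dotp (R : realType) (d : nat) (x y : 'rV[R]_d) : R :=
  \sum_(i < d) x 0 i * y 0 i.

Definition conv_hull (R : realType) (d : nat) (S : set 'rV[R]_d) :
    set 'rV[R]_d :=
  smallest (@convex_set R 'rV[R]_d) S.

Definition polytope (R : realType) (d : nat) (P : set 'rV[R]_d) : Prop :=
  exists2 S : set 'rV[R]_d, finite_set S & P = conv_hull S.

Definition polar (R : realType) (d : nat) (S : set 'rV[R]_d) :
    set 'rV[R]_d :=
  [set x | forall s, S s -> dotp x s <= 1].

Definition translate (R : realType) (d : nat) (P : set 'rV[R]_d)
    (c : 'rV[R]_d) : set 'rV[R]_d :=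
  [set x - c | x in P].

(* The inequality may be trivial (a = 0, b = 0), so Q is a face of itself. *)
Definition face (R : realType) (d : nat) (Q F : set 'rV[R]_d) : Prop :=
  exists (a : 'rV[R]_d) (b : R),
    (forall x, Q x -> dotp a x <= b) /\ F = [set x | Q x /\ dotp a x = b].

Definition vertices (R : realType) (d : nat) (Q : set 'rV[R]_d) :
    set 'rV[R]_d :=
  [set v | face Q [set v]].

(* Main.v *)
Require Import Defs.
From mathcomp Require Import all_boot all_order all_algebra.
From mathcomp Require Import all_classical all_reals all_analysis.
From mathcomp Require Import ring lra.
Import Order.TTheory GRing.Theory Num.Theory.
Import numFieldNormedType.Exports.
Local Open Scope classical_set_scope.
Local Open Scope ring_scope.
Set Implicit Arguments.
Unset Strict Implicit.
Unset Printing Implicit Defensive.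

(** The point c is the analytic center of P with respect to its facets.  If P is
    cut out by the facet inequalities <a_i, x> <= b_i, the vertices of the polar
    of P - c are the vectors a_i / (b_i - <a_i, c>), one for each facet, and
    minus their sum is the gradient at c of the function
    x |-> sum_i log (b_i - <a_i, x>).  This function tends to -oo at the boundary
    of P, so it has a maximum in the interior, and there the sum vanishes.  The
    proof maximizes the product of the slacks instead of the sum of their
    logarithms, as the product is continuous on all of P.

    The facets are not constructed; they are read off the polar itself.  Fix an
    interior point c0 and let V be the vertex set of the polar of P - c0.

    - A point v of a polar of a finite set T is a vertex exactly when no other
      point of the polar is tight at every t in T at which v is tight
      ([vertices_polarP]).  This makes V finite ([finite_vertices_polar]), and it
      makes vertices behave well under change of center: the projective map
      [recenter], v |-> v / (1 - <v, c - c0>), carries the polar of P - c0 onto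
      that of P - c, preserves tightness, and so carries vertices to vertices
      ([vertices_recenter]).

    - The inequalities <v, x - c0> <= 1 for v in V define the closure of P
      ([vertex_constraints_closure]): a point x outside the closure is separated
      from P by some y in the polar ([polar_separation]), and <y, x - c0> can be
      raised until y is a vertex ([vertex_ge]).

    - The product over V of the slacks 1 - <v, x - c0> has a maximum c on the
      compact set where all slacks are nonnegative.  All slacks are positive at
      c, so c is interior ([open_closure_interior]).  The derivative at c in
      direction w is minus the product times the inner product with w of the sum
      of the vectors v / (1 - <v, c - c0>), which are the vertices of the polar
      of P - c.  Taking w to be this sum gives <w, w> = 0. *)

(** * The inner product *)

Section InnerProduct.
Context {R : realType} {d : nat}.
Implicit Types (x y z : 'rV[R]_d) (a : R).

Lemma dotpC x y : dotp x y = dotp y x.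
Proof. by apply: eq_bigr => i _; rewrite mulrC. Qed.

Lemma dotpDl x y z : dotp (x + y) z = dotp x z + dotp y z.
Proof. by rewrite -big_split; apply: eq_bigr => i _; rewrite mxE mulrDl. Qed.

Lemma dotpZl a x y : dotp (a *: x) y = a * dotp x y.
Proof. by rewrite mulr_sumr; apply: eq_bigr => i _; rewrite mxE mulrA. Qed.

Lemma dotpDr x y z : dotp z (x + y) = dotp z x + dotp z y.
Proof. by rewrite !(dotpC z) dotpDl. Qed.

Lemma dotpZr a x y : dotp y (a *: x) = a * dotp y x.
Proof. by rewrite !(dotpC y) dotpZl. Qed.

Lemma dotpNl x y : dotp (- x) y = - dotp x y.
Proof. by rewrite -scaleN1r dotpZl mulN1r. Qed.

Lemma dotpNr x y : dotp y (- x) = - dotp y x.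
Proof. by rewrite !(dotpC y) dotpNl. Qed.

Definition dotpE := (dotpDl, dotpDr, dotpZl, dotpZr, dotpNl, dotpNr).

Lemma dotp0l x : dotp 0 x = 0.
Proof. by rewrite -(scale0r x) dotpZl mul0r. Qed.

Lemma dotp_suml (I : Type) (r : seq I) (F : I -> 'rV[R]_d) y :
  dotp (\sum_(i <- r) F i) y = \sum_(i <- r) dotp (F i) y.
Proof.
elim: r => [|i r IH]; first by rewrite !big_nil dotp0l.
by rewrite !big_cons dotpDl IH.
Qed.

Lemma dotp_ge0 x : 0 <= dotp x x.
Proof. by apply: sumr_ge0 => i _; rewrite -expr2 sqr_ge0. Qed.

Lemma dotp_eq0 x : (dotp x x == 0) = (x == 0).
Proof.
apply/eqP/eqP => [/psumr_eq0P x0|->]; last by rewrite dotp0l.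
apply/rowP => i; rewrite mxE; apply/eqP; rewrite -sqrf_eq0 expr2.
by apply/eqP/x0 => // j _; rewrite -expr2 sqr_ge0.
Qed.

Lemma dotp_gt0 x : (0 < dotp x x) = (x != 0).
Proof. by rewrite lt_neqAle dotp_ge0 andbT eq_sym dotp_eq0. Qed.

Lemma continuous_dotpr y : continuous (dotp y).
Proof.
apply: (@continuous_big R^o _ +%R 0 xpredT (@add_continuous R^o) 'rV[R]_d _
  (fun i x => y 0 i * x 0 i)) => i _ x.
by apply: continuousM; [exact: cst_continuous | exact: coord_continuous].
Qed.

Lemma continuous_dotp_self : continuous (fun x => dotp x x).
Proof.
apply: (@continuous_big R^o _ +%R 0 xpredT (@add_continuous R^o) 'rV[R]_d _
  (fun i x => x 0 i * x 0 i)) => i _ x.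
by apply: continuousM; exact: coord_continuous.
Qed.

End InnerProduct.

Lemma continuous_affine (R : realType) d (a : 'rV[R]_d) (k : R) :
  continuous (fun y : 'rV[R]_d => a + k *: y).
Proof.
move=> y; apply: continuousD; first exact: cst_continuous.
exact: scaler_continuous.
Qed.

(** * Convex hulls, interiors and separation *)

Section ConvexHull.
Context {R : realType} {d : nat}.
Implicit Types (A S : set 'rV[R]_d) (x y z : 'rV[R]_d).

(** Replaces the bundled weights of convex spaces by scalars in [0, 1]. *)
Lemma convex_setP A :
  @convex_set R 'rV[R]_d A <->
  forall (t : R) x y, 0 <= t <= 1 -> A x -> A y -> A (t *: x + (1 - t) *: y).
Proof.
split=> [cA t x y /andP[t0 t1] Ax Ay|cA x y t /set_mem Ax /set_mem Ay].
  have := cA x y (@Itv01 R t t0 t1) (mem_set Ax) (mem_set Ay).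
  by move/set_mem.
apply/mem_set; apply: cA => //.
by apply/andP; split; [exact: ge0 | exact: le1].
Qed.

Lemma convex_conv_hull S : @convex_set R 'rV[R]_d (conv_hull S).
Proof.
apply/convex_setP => t x y t01 Sx Sy B [cB SB].
by move/convex_setP: (cB); apply => //; [apply: Sx | apply: Sy].
Qed.

Lemma conv_hull_le S y b :
  (forall s, S s -> dotp y s <= b) -> forall x, conv_hull S x -> dotp y x <= b.
Proof.
move=> Sb; apply: smallest_sub => //; apply/convex_setP => t u v t01 /= ub vb.
by rewrite !dotpE; nra.
Qed.

Lemma bounded_closure_conv_hull (s : seq 'rV[R]_d) :
  bounded_set (closure (conv_hull [set` s])).
Proof.
pose M := \sum_(x <- s) `|x|.
have : closure (conv_hull [set` s]) `<=` [set x | `|x| <= M].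
  rewrite [X in X `<=` _]closureE; apply: smallest_sub.
    rewrite (_ : [set x | _] = (fun x : 'rV[R]_d => `|x|) @^-1` [set r | r <= M])//.
    by apply: preimage_closed; [move=> x _; exact: norm_continuous | exact: closed_le].
  apply: smallest_sub.
    apply/convex_setP => t x y /andP[t0 t1] /= xM yM.
    rewrite (le_trans (ler_normD _ _))// !normrZ ger0_norm// ger0_norm ?subr_ge0//.
    by nra.
  move=> x /= xs; rewrite /M (big_rem x)//= lerDl.
  by apply: sumr_ge0.
move=> clM; exists M; split; first exact: num_real.
by move=> N MN x /clM /= /le_trans; apply; exact: ltW.
Qed.

Lemma interior_ray A x w : interior A x -> exists2 e : R, 0 < e & A (x + e *: w).
Proof.
move=> /nbhs_ballP[e /= e0 eA].
have w0 : 0 < `|w| + 1 by rewrite ltr_wpDl.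
exists (e / 2 / (`|w| + 1)); first by rewrite !divr_gt0.
apply: eA; rewrite -ball_normE /= opprD addrA subrr sub0r normrN normrZ.
rewrite gtr0_norm ?divr_gt0// mulrAC ltr_pdivrMr//.
have := normr_ge0 w; nra.
Qed.

Lemma conv_closure A t q z : @convex_set R 'rV[R]_d A -> 0 <= t <= 1 ->
  A q -> closure A z -> closure A (t *: q + (1 - t) *: z).
Proof.
move=> /convex_setP cA t01 Aq.
pose f y : 'rV[R]_d := t *: q + (1 - t) *: y.
suff : closure A `<=` f @^-1` closure A by apply.
rewrite [X in X `<=` _]closureE; apply: smallest_sub.
  apply: preimage_closed; last exact: closed_closure.
  by move=> y _; exact: continuous_affine.
by move=> y Ay; apply: subset_closure; exact: cA.
Qed.

(** A convex set with an interior point has the same interior as its closure.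
    A point x of U is pushed away from the interior point c0 to a point z of the
    closure; any y in A close to z then sees x on a segment ending close to c0,
    hence in A.  This makes it possible to work with the closure of P without
    proving that P is closed. *)
Lemma open_closure_interior A U c0 : @convex_set R 'rV[R]_d A ->
  interior A c0 -> open U -> U `<=` closure A -> U `<=` interior A.
Proof.
move=> /convex_setP cA Ac0 oU UA.
rewrite -(open_subsetE _ oU) => x Ux.
have [e e0 Uz] : exists2 e : R, 0 < e & U (x + e *: (x - c0)).
  by apply: interior_ray; move/interior_id: oU => ->.
set z := x + _ in Uz.
pose t := e / (1 + e).
have t1 : 0 < 1 + e by lra.
(* g y is the other end of the segment from y through x *)
pose g y : 'rV[R]_d := c0 + e^-1 *: (z - y).
have gz : g z = c0 by rewrite /g subrr scaler0 addr0.
have /UA/(_ (g @^-1` A))[|y [Ay Agy]] := Uz.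
  have gc : continuous g.
    rewrite (_ : g = fun y => (c0 + e^-1 *: z) + (- e^-1) *: y).
      exact: continuous_affine.
    by apply/funext => y; rewrite /g scalerBr scaleNr addrA.
  by apply: gc; rewrite gz.
have -> : x = t *: g y + (1 - t) *: y.
  apply/rowP => i; rewrite /t /g /z !mxE; field.
  by rewrite !gt_eqF.
apply: cA => //; rewrite /t; apply/andP; split; first by rewrite divr_ge0 ?ltW.
by rewrite ler_pdivrMr//; lra.
Qed.

(** The normal at the point p of the closure nearest to x separates x from A.
    The interior point c0 lies strictly on the far side of the hyperplane through
    p, so the normal can be scaled to take the value 1 at p - c0, which puts it
    in the polar. *)
Lemma polar_separation A c0 x : @convex_set R 'rV[R]_d A ->
  compact (closure A) -> interior A c0 -> ~ closure A x ->
  exists2 y, polar (translate A c0) y & 1 < dotp y (x - c0).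
Proof.
move=> cA Acpt Ac0 Ax.
have Ac0' : A c0 by exact: interior_subset.
have [p /set_mem Ap pmin] : exists2 p, p \in closure A &
    forall q, q \in closure A -> dotp (x - p) (x - p) <= dotp (x - q) (x - q).
  apply: (@EVT_min_rV R d (fun q => dotp (x - q) (x - q))) => //.
    by exists c0; exact: subset_closure.
  have sub_cont : continuous (fun q : 'rV[R]_d => x - q).
    rewrite (_ : (fun q : 'rV[R]_d => x - q) = fun q => x + (- 1) *: q).
      exact: continuous_affine.
    by apply/funext => r; rewrite scaleN1r.
  apply: continuous_subspaceT => q.
  exact: (continuous_comp (@sub_cont q) (@continuous_dotp_self R d _)).
have [w wE] : exists w, w = x - p by exists (x - p).
rewrite -wE in pmin.
have w0 : 0 < dotp w w.
  by rewrite dotp_gt0 wE subr_eq0; apply: contra_notN Ax => /eqP ->.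
(* otherwise the point at parameter t of the segment from p to q is closer to x;
   t is a damped form of the minimizer u / b of -2tu + t^2 b, u = <w, q - p>,
   so as to stay below 1 *)
have obtuse q : A q -> dotp w (q - p) <= 0.
  move=> Aq; rewrite leNgt; apply/negP => wq.
  set b := dotp (q - p) (q - p).
  have b0 : 0 <= b by exact: dotp_ge0.
  pose t := dotp w (q - p) / (dotp w (q - p) + b).
  have D0 : 0 < dotp w (q - p) + b by lra.
  have t0 : 0 < t by exact: divr_gt0.
  have t1 : t <= 1 by rewrite ler_pdivrMr//; lra.
  have tD : t * (dotp w (q - p) + b) = dotp w (q - p) by rewrite divfK ?gt_eqF.
  have t01 : 0 <= t <= 1 by rewrite t1 ltW.
  have := pmin _ (mem_set (conv_closure cA t01 Aq Ap)).
  have -> : x - (t *: q + (1 - t) *: p) = w - t *: (q - p).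
    by rewrite wE; apply/rowP => i; rewrite !mxE; ring.
  rewrite !(dotpDl w, dotpDr w, dotpNl, dotpNr, dotpZl, dotpZr).
  rewrite (dotpC (q - p) w) -/b.
  have -> : t * b = dotp w (q - p) - t * dotp w (q - p) by lra.
  have tu0 : 0 < t * dotp w (q - p) by exact: mulr_gt0.
  rewrite !mulrN !mulrBr; have := mulr_gt0 t0 tu0; lra.
have D0 : 0 < dotp w (p - c0).
  have [e e0 /obtuse] := interior_ray w Ac0.
  by rewrite !(dotpDr, dotpNr, dotpZr); have := mulr_gt0 e0 w0; lra.
exists ((dotp w (p - c0))^-1 *: w).
  move=> _ [q Aq <-]; rewrite dotpZl mulrC ler_pdivrMr// mul1r.
  have := obtuse _ Aq; rewrite !(dotpDr, dotpNr); lra.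
rewrite dotpZl mulrC ltr_pdivlMr// mul1r.
by rewrite -(subrK p x) -wE -addrA (dotpDr w); lra.
Qed.

End ConvexHull.

(** * Vertices of the polar of a finite set *)

Section PolyhedronVertices.
Context {R : realType} {d : nat}.
Implicit Types (T : seq 'rV[R]_d) (u v w y z : 'rV[R]_d).

(** The constraints tight at v stay tight along the line through v and y; the
    others have positive slack at v, so that a short step is harmless. *)
Lemma polar_step_back T v y : polar [set` T] v ->
  (forall t, t \in T -> dotp v t = 1 -> dotp y t = 1) ->
  exists2 e : R, 0 < e & polar [set` T] (v - e *: (y - v)).
Proof.
move=> Qv tighty.
(* the inverse of the step; the summand 1 keeps it positive when no
   constraint is slack *)
pose B := 1 + \sum_(t <- T | dotp v t != 1) (`|dotp y t| + `|dotp v t|) / (1 - dotp v t).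
have slack t : t \in T -> dotp v t != 1 -> 0 < 1 - dotp v t.
  by move=> tT vt; rewrite subr_gt0 lt_neqAle vt Qv.
have term_ge0 t : t \in T -> dotp v t != 1 ->
    0 <= (`|dotp y t| + `|dotp v t|) / (1 - dotp v t).
  by move=> tT vt; apply: divr_ge0; [exact: addr_ge0|exact/ltW/slack].
have B0 : 0 < B.
  rewrite ltr_pwDl// big_seq_cond; apply: sumr_ge0 => t /andP[]; exact: term_ge0.
exists B^-1; first by rewrite invr_gt0.
move=> t /= tT; rewrite !dotpE.
have [vt1|vt1] := eqVneq (dotp v t) 1; first by rewrite tighty// vt1; lra.
have st := slack _ tT vt1.
have : (`|dotp y t| + `|dotp v t|) / (1 - dotp v t) <= B.
  rewrite /B (big_rem t)//= vt1.
  have : 0 <= \sum_(x <- rem t T | dotp v x != 1)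
      (`|dotp y x| + `|dotp v x|) / (1 - dotp v x).
    rewrite big_seq_cond; apply: sumr_ge0 => x /andP[/mem_rem]; exact: term_ge0.
  lra.
rewrite ler_pdivrMr// mulrC -ler_pdivrMr// mulrC => h.
suff : B^-1 * (dotp v t - dotp y t) <= B^-1 * (`|dotp y t| + `|dotp v t|) by lra.
rewrite ler_pM2l ?invr_gt0//; have := ler_norm (- dotp y t); rewrite normrN.
have := ler_norm (dotp v t); lra.
Qed.

(** Exposed points described by incidences only.  If y is tight wherever v is,
    then v lies strictly between y and another point of the polar, so that any
    face containing v contains y.  Conversely the sum of the constraints tight at
    v is a functional maximal exactly at the points tight wherever v is. *)
Lemma vertices_polarP T v : vertices (polar [set` T]) v <->
  polar [set` T] v /\
  forall y, polar [set` T] y -> (forall t, t \in T -> dotp v t = 1 -> dotp y t = 1) ->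
    y = v.
Proof.
split=> [[a [b [aQ vE]]]|[Qv vuniq]].
  have [Qv av] : polar [set` T] v /\ dotp a v = b.
    by have : [set v] v by []; rewrite vE.
  split=> // y Qy tighty.
  suff : [set v] y by [].
  rewrite vE; split=> //; apply/eqP; rewrite eq_le aQ//=.
  have [e e0 /aQ] := polar_step_back Qv tighty.
  rewrite -av !dotpE => h.
  have : 0 <= e * (dotp a y - dotp a v) by lra.
  by rewrite pmulr_rge0// subr_ge0.
pose a := \sum_(t <- T | dotp v t == 1) t.
exists a, (\sum_(t <- T | dotp v t == 1) 1).
have aE x : dotp a x = \sum_(t <- T | dotp v t == 1) dotp x t.
  by rewrite /a -big_filter dotp_suml big_filter; apply: eq_bigr => t _; rewrite dotpC.
have aQ x : polar [set` T] x -> dotp a x <= \sum_(t <- T | dotp v t == 1) 1.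
  move=> Qx; rewrite aE big_seq_cond [leRHS]big_seq_cond.
  by apply: ler_sum => t /andP[tT _]; exact: Qx.
split=> //; apply/seteqP; split=> [x ->|x [Qx ax]] /=.
  by split=> //; rewrite aE; apply: eq_bigr => t /eqP.
apply: vuniq => // t tT vt; apply/eqP; rewrite eq_le Qx//=.
rewrite leNgt; apply/negP => xt.
have : dotp a x < \sum_(t <- T | dotp v t == 1) 1.
  rewrite aE (big_rem t)//= [ltRHS](big_rem t)//= vt eqxx ltr_leD//.
  rewrite big_seq_cond [leRHS]big_seq_cond.
  by apply: ler_sum => s /andP[/mem_rem sT _]; exact: Qx.
by rewrite ax ltxx.
Qed.

(** A vertex is determined by its set of tight constraints. *)
Lemma finite_vertices_polar T : finite_set (vertices (polar [set` T])).
Proof.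
pose tight v := map_tuple (fun t => dotp v t == 1) (in_tuple T).
pose vertex_of b := xget 0 [set v | vertices (polar [set` T]) v /\ tight v = b].
apply: (@sub_finite_set _ _ (vertex_of @` setT)); last first.
  by apply: finite_image; exact: finite_finset.
move=> v Vv; exists (tight v) => //.
rewrite /vertex_of; case: xgetP => [w wx [/vertices_polarP[Qw _] wv]|/(_ v)[]//].
have /vertices_polarP[_] := Vv; apply=> // t tT vt.
have /eq_in_map/(_ t tT) := congr1 val wv.
by rewrite vt eqxx => /eqP.
Qed.

(** A linear form on the polar is dominated at a vertex.  A point y that is not a
    vertex can move along a line that keeps its tight constraints, in the
    direction in which the form does not decrease, until a further constraint
    becomes tight; the hypothesis on T, boundedness of the polar, guarantees that
    this happens.  The induction is on the number of constraints not yet tight. *)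
Lemma vertex_ge T : (forall w, w != 0 -> exists2 t, t \in T & 0 < dotp w t) ->
  forall y u, polar [set` T] y ->
  exists2 v, vertices (polar [set` T]) v & dotp y u <= dotp v u.
Proof.
move=> Tpos y u.
have [n] := ubnP (count (fun t => dotp y t != 1) T).
elim: n y => // n IH y ltn Qy.
have [Vy|nVy] := pselect (vertices (polar [set` T]) y); first by exists y.
have [z [Qz tightz zy]] : exists z, [/\ polar [set` T] z,
    forall t, t \in T -> dotp y t = 1 -> dotp z t = 1 & z != y].
  apply: contrapT => noz; apply: nVy; apply/vertices_polarP; split=> // z Qz tightz.
  by apply: contrapT => /eqP zy; apply: noz; exists z.
have [w [w0 tightw wu]] : exists w, [/\ w != 0,
    forall t, t \in T -> dotp y t = 1 -> dotp w t = 0 & 0 <= dotp w u].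
  have [wu|wu] := lerP 0 (dotp (z - y) u).
    exists (z - y); split=> //; first by rewrite subr_eq0.
    by move=> t tT yt; rewrite !dotpE tightz// yt subrr.
  exists (y - z); split=> //; first by rewrite subr_eq0 eq_sym.
    by move=> t tT yt; rewrite !dotpE tightz// yt subrr.
  by move: wu; rewrite !dotpE; lra.
have [t0 t0T t0w] := Tpos _ w0.
pose F := [seq t <- T | 0 < dotp w t].
(* r t is the time at which constraint t becomes tight *)
pose r t := (1 - dotp y t) / dotp w t.
have [t1 [t1T wt1 t1min]] : exists t1, [/\ t1 \in T, 0 < dotp w t1 &
    forall t, t \in T -> 0 < dotp w t -> r t1 <= r t].
  have : t0 \in F by rewrite mem_filter t0w.
  have : forall G : seq 'rV[R]_d, t0 \in G ->
      exists2 t1, t1 \in G & forall t, t \in G -> r t1 <= r t.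
    move=> G t0G; have i0 : 'I_(size G).
      by exists (index t0 G); rewrite index_mem.
    have [i _ imin] := @arg_minP _ _ _ i0 xpredT (fun i : 'I_(size G) => r (nth 0 G i)) isT.
    exists (nth 0 G i); first exact: mem_nth.
    move=> t tG; have it : (index t G < size G)%N by rewrite index_mem.
    by have := imin (Ordinal it) isT; rewrite /= nth_index.
  move=> /[apply] -[t1]; rewrite mem_filter => /andP[wt1 t1T] t1min.
  by exists t1; split=> // t tT wt; apply: t1min; rewrite mem_filter wt.
have r0 : 0 <= r t1 by rewrite divr_ge0 ?(ltW wt1)// subr_ge0 Qy.
have Qy' : polar [set` T] (y + r t1 *: w).
  move=> t /= tT; rewrite !dotpE.
  have [wt|wt] := lerP (dotp w t) 0.
    by have := Qy _ tT; have := mulr_ge0_le0 r0 wt; lra.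
  have := t1min _ tT wt; rewrite [r t]/r ler_pdivlMr//; lra.
have [||v Vv yv] := IH (y + r t1 *: w) => //.
  have sub t : t \in T -> dotp (y + r t1 *: w) t != 1 -> dotp y t != 1.
    move=> tT; apply: contraNN => /eqP yt.
    by rewrite !dotpE yt tightw// mulr0 addr0.
  have yt1 : dotp y t1 != 1.
    by apply: contraTN wt1 => /eqP /(tightw _ t1T) ->; rewrite ltxx.
  have y't1 : dotp (y + r t1 *: w) t1 == 1.
    by rewrite !dotpE /r; apply/eqP; field; rewrite gt_eqF.
  apply: (@leq_trans (count (fun t => dotp y t != 1) T)); last by rewrite -ltnS.
  have /permP TE := perm_to_rem t1T.
  rewrite !TE /= y't1 yt1 /= ltnS; set a1 := (X in (count X _ <= _)%N); set a2 := (X in (_ <= count X _)%N).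
  rewrite (eq_in_count (a2 := predI a1 a2)); last first.
    move=> t /mem_rem tT /=; rewrite /a1 /a2.
    by case: (boolP (dotp (y + _) t != 1)) => // /(sub _ tT) ->.
  by apply: sub_count => t /andP[].
exists v => //; apply: le_trans yv; rewrite !dotpE lerDl.
exact: mulr_ge0.
Qed.

End PolyhedronVertices.

(** * Change of center *)

Section Recentering.
Context {R : realType} {d : nat}.
Implicit Types (P : set 'rV[R]_d) (s : seq 'rV[R]_d) (c e v x y : 'rV[R]_d).

Lemma polar_translate_conv_hull s c :
  polar (translate (conv_hull [set` s]) c) = polar [set` [seq x - c | x <- s]].
Proof.
apply/seteqP; split=> y /= yQ.
  by move=> _ /mapP[x xs ->]; apply: yQ; exists x => //; exact: sub_gen_smallest.
move=> _ [x Px <-]; rewrite dotpDr dotpNr lerBlDr.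
apply: conv_hull_le Px => z zs; rewrite -lerBlDr -dotpNr -dotpDr.
by apply: yQ; exact: map_f.
Qed.

Lemma vertices_polar_conv_hullP s c v (Q := polar (translate (conv_hull [set` s]) c)) :
  vertices Q v <-> Q v /\
  forall y, Q y ->
    (forall x, x \in s -> dotp v (x - c) = 1 -> dotp y (x - c) = 1) -> y = v.
Proof.
rewrite /Q polar_translate_conv_hull; split=> [/vertices_polarP[Qv vuniq]|[Qv vuniq]].
  by split=> // y Qy tighty; apply: vuniq => // _ /mapP[x xs ->]; exact: tighty.
apply/vertices_polarP; split=> // y Qy tighty; apply: vuniq => // x xs.
by apply: tighty; exact: map_f.
Qed.

Lemma polar_interior_lt1 P c0 c v :
  interior P c -> polar (translate P c0) v -> dotp v (c - c0) < 1.
Proof.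
move=> Pc Qv; have [->|v0] := eqVneq v 0; first by rewrite dotp0l.
have [e e0 Pe] := interior_ray v Pc.
have := Qv (c + e *: v - c0); rewrite /translate /= => /(_ (ex_intro2 _ _ _ Pe erefl)).
have : 0 < e * dotp v v by rewrite mulr_gt0 ?dotp_gt0.
rewrite !(dotpDr, dotpNr, dotpZr); lra.
Qed.

(** The half-space <v, x> <= 1 with respect to an origin shifted to e. *)
Definition recenter e v := (1 - dotp v e)^-1 *: v.

(** Slacks are rescaled by a positive factor that does not depend on x: this is
    why recentering preserves both the constraints and their tightness. *)
Lemma recenter_slack e v x : dotp v e < 1 ->
  1 - dotp (recenter e v) (x - e) = (1 - dotp v x) / (1 - dotp v e).
Proof.
by move=> ve; rewrite /recenter !dotpE; field; rewrite subr_eq0 gt_eqF.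
Qed.

Lemma recenter_le1 e v x : dotp v e < 1 ->
  (dotp (recenter e v) (x - e) <= 1) = (dotp v x <= 1).
Proof.
move=> ve; rewrite -subr_ge0 recenter_slack// pmulr_lge0 ?subr_ge0//.
by rewrite invr_gt0 subr_gt0.
Qed.

Lemma recenter_eq1 e v x : dotp v e < 1 ->
  (dotp (recenter e v) (x - e) == 1) = (dotp v x == 1).
Proof.
move=> ve; rewrite eq_sym -subr_eq0 recenter_slack// mulf_eq0 invr_eq0 !subr_eq0.
by rewrite (gt_eqF ve) orbF eq_sym.
Qed.

Lemma recenterK e v : dotp v e < 1 -> recenter (- e) (recenter e v) = v.
Proof.
move=> ve; rewrite {1}/recenter -[- e]add0r recenter_slack// /recenter.
rewrite [dotp v 0]dotpC dotp0l subr0 mul1r invrK scalerA divff ?scale1r//.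
by rewrite subr_eq0 gt_eqF.
Qed.

Lemma polar_recenter P c0 c v : interior P c ->
  polar (translate P c0) v -> polar (translate P c) (recenter (c - c0) v).
Proof.
move=> Pc Qv _ [x Px <-]; have ve := polar_interior_lt1 Pc Qv.
have -> : x - c = (x - c0) - (c - c0) by rewrite opprB addrA subrK.
by rewrite recenter_le1//; apply: Qv; exists x.
Qed.

(** A competitor y of the recentered vertex is recentered back to a competitor of
    v, hence to v itself. *)
Lemma vertices_recenter_sub s c0 c v (P := conv_hull [set` s]) :
  interior P c0 -> interior P c -> vertices (polar (translate P c0)) v ->
  vertices (polar (translate P c)) (recenter (c - c0) v).
Proof.
move=> Pc0 Pc /vertices_polar_conv_hullP[Qv vuniq].
apply/vertices_polar_conv_hullP; rewrite -/P.
split=> [|y Qy tighty]; first exact: polar_recenter.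
have ye := polar_interior_lt1 Pc0 Qy; have ve := polar_interior_lt1 Pc Qv.
have sub_shift x a b : x - b = (x - a) - (b - a) :> 'rV[R]_d.
  by rewrite opprB addrA subrK.
suff /(congr1 (recenter (c - c0))) : recenter (c0 - c) y = v.
  by rewrite -{1}(opprB c0) recenterK.
apply: vuniq; first exact: polar_recenter.
move=> x xs vx; apply/eqP; rewrite (sub_shift x c) recenter_eq1//.
apply/eqP/tighty => //.
by apply/eqP; rewrite (sub_shift x c0) recenter_eq1// vx.
Qed.

Lemma vertices_recenter s c0 c (P := conv_hull [set` s]) :
  interior P c0 -> interior P c ->
  vertices (polar (translate P c)) =
    recenter (c - c0) @` vertices (polar (translate P c0)).
Proof.
move=> Pc0 Pc; apply/seteqP; split=> [v Vv|_ [v Vv <-]]; last first.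
  exact: vertices_recenter_sub.
exists (recenter (c0 - c) v); first exact: vertices_recenter_sub.
rewrite -(opprB c0) recenterK//; apply: polar_interior_lt1 Pc0 _.
by have /vertices_polar_conv_hullP[] := Vv.
Qed.

(** The bipolar theorem with the vertices of the polar in place of the whole
    polar. *)
Lemma vertex_constraints_closure s c0 x (P := conv_hull [set` s]) : interior P c0 ->
  (forall v, vertices (polar (translate P c0)) v -> dotp v (x - c0) <= 1) ->
  closure P x.
Proof.
move=> Pc0 xV; apply: contrapT => nPx.
have Pcpt : compact (closure P).
  apply: bounded_closed_compact; first exact: bounded_closure_conv_hull.
  exact: closed_closure.
have cP : @convex_set R 'rV[R]_d P by exact: convex_conv_hull.
have [y] := polar_separation cP Pcpt Pc0 nPx.
rewrite /P polar_translate_conv_hull => Qy yx.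
have [w w0|v] := vertex_ge _ (x - c0) Qy; last first.
  rewrite -polar_translate_conv_hull => /xV vx yv.
  by have := lt_le_trans yx (le_trans yv vx); rewrite ltxx.
(* the polar is bounded: otherwise P lies in a half-space with c0 on its
   boundary *)
apply: contrapT => now.
have [e e0] := interior_ray w Pc0.
move=> /(conv_hull_le (y := w) (b := dotp w c0)) h.
have /h : forall z, [set` s] z -> dotp w z <= dotp w c0.
  move=> z zs; rewrite -subr_le0 -dotpNr -dotpDr leNgt; apply/negP => wz.
  by apply: now; exists (z - c0) => //; exact: map_f.
rewrite dotpDr dotpZr gerDl pmulr_rle0// leNgt dotp_gt0 w0//.
Qed.

End Recentering.

(** * The analytic center *)

Lemma logderiv_prod_affine (R : realFieldType) (I : Type) (r : seq I) (a b : I -> R) :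
  (forall i, a i != 0) ->
  (\prod_(i <- r) ((a i)%:P + b i *: 'X))^`().[0] =
    (\prod_(i <- r) a i) * \sum_(i <- r) b i / a i.
Proof.
move=> a0; elim: r => [|i r IH]; first by rewrite !big_nil derivC horner0 mulr0.
rewrite !big_cons derivM hornerD !hornerM IH derivD derivC derivZ derivX.
rewrite horner_prod (eq_bigr a) => [|j _]; rewrite !hornerE //=.
by field.
Qed.

Lemma poly_max_deriv0 (R : realType) (p : {poly R}) (e : R) : 0 < e ->
  (forall t, - e < t < e -> p.[t] <= p.[0]) -> p^`().[0] = 0.
Proof.
move=> e0 pmax.
have : is_derive (0 : R) (1 : R) (horner p) 0.
  apply: (@derive1_at_max R (horner p) (- e) e 0); [lra|by []| |].
    by rewrite in_itv /=; lra.
  by move=> t; rewrite in_itv /= => /pmax.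
by move=> h; rewrite -(@derive_val _ _ _ _ _ _ _ (is_derive_poly p 0)) derive_val.
Qed.

(* A finitely supported sum over an infinite set would be 0 by convention,
   whence the explicit finiteness of the set of vertices. *)
Theorem theorem1p5 (R : realType) (d : nat) (hd : (0 < d)%N)
    (P : set 'rV[R]_d) (hP : polytope P) (hint : interior P !=set0) :
  exists2 c : 'rV[R]_d, interior P c &
    finite_set (vertices (polar (translate P c))) /\
    \sum_(v \in vertices (polar (translate P c))) v = 0.
Proof.
have [S /finite_seqP[s ->] PE] := hP; have [c0 Pc0] := hint.
rewrite {}PE in Pc0 *; set P0 := conv_hull _ in Pc0 *.
pose V := vertices (polar (translate P0 c0)).
have finV : finite_set V.
  by rewrite /V polar_translate_conv_hull; exact: finite_vertices_polar.
have QV v : V v -> polar (translate P0 c0) v.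
  by move/vertices_polar_conv_hullP => [].
pose slack v (x : 'rV[R]_d) : R := 1 - dotp v (x - c0).
have slackE v x : slack v x = (1 + dotp v c0) - dotp v x.
  by rewrite /slack !dotpE; ring.
have slack_cont v : continuous (slack v).
  move=> x; rewrite (_ : slack v = fun x => (1 + dotp v c0) - dotp v x); last first.
    by apply/funext => z; exact: slackE.
  apply: (@continuousB R R^o _ (cst _) (dotp v)); first exact: cst_continuous.
  exact: continuous_dotpr.
have [r0 Vr0] := (finite_seqP _).1 finV; pose r := undup r0.
have Vr : V = [set` r] by rewrite Vr0; apply/seteqP; split=> v /=; rewrite mem_undup.
have rV v : (v \in r) <-> V v by rewrite Vr.
pose K := [set x | forall v, V v -> 0 <= slack v x].
pose U := [set x | forall v, V v -> 0 < slack v x].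
have KP : K `<=` closure P0.
  move=> x Kx; apply: (vertex_constraints_closure Pc0) => v Vv.
  by rewrite -subr_ge0; exact: Kx.
have Kcpt : compact K.
  apply: bounded_closed_compact.
    have [M [Mreal MP]] := bounded_closure_conv_hull s.
    by exists M; split=> // N /MP PN x /KP; exact: PN.
  rewrite (_ : K = \bigcap_(v in V) (slack v @^-1` [set t | 0 <= t])); last first.
    by apply/seteqP; split.
  apply: closed_bigI => v _; apply: preimage_closed; last exact: closed_ge.
  by move=> x _; exact: slack_cont.
have Uopen : open U.
  rewrite (_ : U = \bigcap_(v in [set` r]) (slack v @^-1` [set t | 0 < t])); last first.
    by rewrite -Vr; apply/seteqP; split.
  rewrite bigcap_seq; elim/big_ind : _ => [|A B|v _]; [exact: openT|exact: openI|].
  apply: open_comp; last exact: open_gt.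
  by move=> x _; exact: slack_cont.
have UP : U `<=` interior P0.
  apply: (open_closure_interior _ Pc0 Uopen); first exact: convex_conv_hull.
  by move=> x Ux; apply: KP => v /Ux /ltW.
pose f x := \prod_(v <- r) slack v x.
have f_cont : continuous f.
  apply: (@continuous_big R^o _ *%R 1 xpredT _ 'rV[R]_d r slack) => [|v _].
    exact: mul_continuous.
  exact: slack_cont.
have Uc0 : U c0 by move=> v _; rewrite /slack subrr dotpC dotp0l subr0.
have Kc0 : K c0 by move=> v /Uc0 /ltW.
have [c /set_mem Kc cmax] := @EVT_max_rV R d f K (ex_intro _ _ Kc0) Kcpt
  (continuous_subspaceT f_cont).
have fc0 : 0 < f c.
  apply: (lt_le_trans _ (cmax _ (mem_set Kc0))).
  by rewrite /f big_seq; apply: prodr_gt0 => v /rV /Uc0.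
have Uc : U c.
  move=> v Vv; rewrite lt_neqAle Kc// andbT eq_sym.
  by move: (lt0r_neq0 fc0); rewrite prodf_seq_neq0 => /allP/(_ v); apply; apply/rV.
have Pc := UP _ Uc.
exists c => //.
rewrite (vertices_recenter Pc0 Pc) -/V; split; first exact: finite_image.
have recenter_inj : set_inj V (recenter (c - c0)).
  move=> v w /set_mem Vv /set_mem Vw /(congr1 (recenter (- (c - c0)))).
  by rewrite !recenterK//; apply: polar_interior_lt1 Pc _; exact: QV.
rewrite fsbig_image// Vr -fsbig_seq ?undup_uniq//.
set w := \sum_(v <- r) _.
apply/eqP; rewrite -dotp_eq0.
have -> : dotp w w = \sum_(v <- r) dotp v w / slack v c.
  by rewrite {1}/w dotp_suml; apply: eq_bigr => v _; rewrite dotpZl mulrC.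
(* the value 1 outside r is a default that makes a nonzero everywhere *)
pose a v := if v \in r then slack v c else 1.
have a0 v : a v != 0.
  by rewrite /a; case: ifPn => [/rV /Uc|_]; [move/gt_eqF => ->|exact: oner_neq0].
have aE v : v \in r -> a v = slack v c by rewrite /a => ->.
(* the product of the slacks restricted to the line through c in direction w *)
pose p := \prod_(v <- r) ((a v)%:P + (- dotp v w) *: 'X).
have pE t : p.[t] = f (c + t *: w).
  rewrite horner_prod /f big_seq [RHS]big_seq; apply: eq_bigr => v vr.
  by rewrite !hornerE aE// !slackE !dotpE; ring.
have [e e0 eK] : exists2 e, 0 < e & forall t, - e < t < e -> K (c + t *: w).
  have line_cont : {for 0, continuous (fun t : R => c + t *: w)}.
    apply: continuousD; first exact: cst_continuous.
    exact: scalel_continuous.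
  have Uc' : U (c + 0 *: w) by rewrite scale0r addr0.
  have /line_cont/nbhs_ballP[e /= e0 eU] := open_nbhs_nbhs (conj Uopen Uc').
  exists e => // t te v Vv; apply/ltW; apply: (eU t) => //.
  by rewrite -ball_normE /= sub0r normrN ltr_norml.
have p0 : p^`().[0] = 0.
  apply: poly_max_deriv0 e0 _ => t /eK Kt.
  by rewrite !pE scale0r addr0; apply: cmax; exact: mem_set.
move: p0; rewrite logderiv_prod_affine// => /eqP.
rewrite mulf_eq0 prodf_seq_eq0 => /orP[/hasP[v _]|]; first by rewrite (negPf (a0 v)).
rewrite -oppr_eq0 -sumrN => /eqP sum0; apply/eqP; rewrite -[RHS]sum0.
by rewrite big_seq [RHS]big_seq; apply: eq_bigr => v vr; rewrite aE// mulNr opprK.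
Qed.
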